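(* Let $G=(V,E)$ be a locally finite graph, and let $x,y\in V$ with $d(x,y)=\delta\ge 2$ (with $\delta$ a finite integer). Then every critical point $p^*\in(0,1)$ of $\kappa_p(x,y)$ satisfies $p^*\ge \frac{1}{1+\operatorname{lcm}(d_x,d_y)}$. In other words, the first linear part of the function $p\mapsto\kappa_p(x,y)$ on $[0,1]$ contains the interval $\left[0,\frac{1}{1+\operatorname{lcm}(d_x,d_y)}\right]$, i.e. the function is affine on this interval.
   Context: Graphs have no multiple edges and no self loops. $d_v$ denotes the degree of the vertex $v$, $w\sim v$ means that $w$ and $v$ are adjacent, and $d(v,w)$ is the combinatorial distance (length of a shortest path). For $v\in V$ and $p\in[0,1]$, $\mu_v^p$ is the probability measure on $V$ with $\mu_v^p(v)=p$, $\mu_v^p(z)=\frac{1-p}{d_v}$ if $z\sim v$, and $\mu_v^p(z)=0$ otherwise. For probability measures $\mu_1,\mu_2$ on $V$, the Wasserstein distance is $W_1(\mu_1,\mu_2)=\inf_{\pi}\sum_{v\in V}\sum_{w\in V} d(v,w)\pi(v,w)$, the infimum over all $\pi:V\times V\to[0,1]$ with $\mu_1(v)=\sum_{w}\pi(v,w)$ and $\mu_2(w)=\sum_{v}\pi(v,w)$. The $p$-Ollivier-Ricci curvature is $\kappa_p(x,y)=1-\frac{W_1(\mu_x^p,\mu_y^p)}{d(x,y)}$. A critical point of $\kappa_p(x,y)$ is a value $p^*\in(0,1)$ such that $\lim_{p\to p^{*-}}\frac{\partial}{\partial p}\kappa_p(x,y)\ne\lim_{p\to p^{*+}}\frac{\partial}{\partial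 p}\kappa_p(x,y)$, i.e. a value of $p$ at which the slope of the piecewise linear function $p\mapsto\kappa_p(x,y)$ changes. *)

(* Defs.v *)
From HB Require Import structures.
From mathcomp Require Import all_boot all_order all_algebra finmap.
From mathcomp Require Import all_classical all_reals all_analysis.

Set Implicit Arguments.
Unset Strict Implicit.
Unset Printing Implicit Defensive.

Import Order.TTheory GRing.Theory Num.Theory.
Import numFieldNormedType.Exports.

Local Open Scope classical_set_scope.
Local Open Scope ring_scope.

(* A graph on V is given by its adjacency relation e; V may be infinite, and
   the graph need not be connected. *)

Definition simple_graph (V : choiceType) (e : rel V) : Prop :=
  symmetric e /\ irreflexive e.

Definition neighbors (V : choiceType) (e : rel V) (v : V) : set V :=
  [set w | e v w].

Definition locally_finite (V : choiceType) (e : rel V) : Prop :=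
  forall v, finite_set (neighbors e v).

(* fset_set of an infinite set is empty, so this is the degree only at vertices
   with finitely many neighbors. *)
Definition degree (V : choiceType) (e : rel V) (v : V) : nat :=
  #|` fset_set (neighbors e v)|%fset.

(* The infimum is a minimum unless v and w lie in different components, in which
   case it is +oo. *)
Definition gdist (R : realType) (V : choiceType) (e : rel V) (v w : V) : \bar R :=
  ereal_inf [set ((size s)%:R)%:E | s in [set s | path e v s /\ last v s = w]].

Definition lazy_measure (R : realType) (V : choiceType) (e : rel V)
    (p : R) (v z : V) : R :=
  if z == v then p else if e v z then (1 - p) / (degree e v)%:R else 0.

Definition transport_plan (R : realType) (V : choiceType) (mu1 mu2 : V -> R)
    (pi : V -> V -> R) : Prop :=
  [/\ forall v w, 0 <= pi v w <= 1,
      forall v, (\esum_(w in [set: V]) (pi v w)%:E = (mu1 v)%:E)%E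
    & forall w, (\esum_(v in [set: V]) (pi v w)%:E = (mu2 w)%:E)%E].

(* Extended-real products satisfy +oo * 0 = 0: a pair of vertices at infinite
   distance costs nothing when no mass is moved between them. *)
Definition transport_cost (R : realType) (V : choiceType) (e : rel V)
    (pi : V -> V -> R) : \bar R :=
  (\esum_(v in [set: V]) \esum_(w in [set: V]) (gdist R e v w * (pi v w)%:E))%E.

Definition W1 (R : realType) (V : choiceType) (e : rel V)
    (mu1 mu2 : V -> R) : \bar R :=
  ereal_inf [set transport_cost e pi | pi in transport_plan mu1 mu2].

(* In a locally finite graph, if 0 < gdist x y < +oo and 0 <= p <= 1, both
   arguments of fine are finite (the supports of the two measures are finite
   and lie in one component), so that fine loses nothing there. *)
Definition kappa (R : realType) (V : choiceType) (e : rel V) (x y : V)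
    (p : R) : R :=
  1 - fine (W1 e (lazy_measure e p x) (lazy_measure e p y))
      / fine (gdist R e x y).

Definition critical_point (R : realType) (f : R -> R) (p : R) : Prop :=
  0 < p < 1 /\
  exists l r : R, [/\ derive1 f @ p^'- --> l, derive1 f @ p^'+ --> r & l <> r].

(* Main.v *)
(* Let L be the lcm of the two degrees. Splitting each neighbor into equal
   copies, a transport plan between the two lazy measures becomes a nonnegative
   matrix of size L + 1 whose rows and columns have sum p at the index of the
   center and s := (1 - p) / L elsewhere. The condition p <= 1 / (1 + L) means
   p <= s. By Birkhoff's theorem the minimal cost is then
   p K + (s - p) J, where K is the cost of an optimal assignment of all L + 1
   points and J that of an optimal assignment of the L copies of neighbors.
   Neither depends on p, and s is affine in p. *)
Require Import Defs.
From HB Require Import structures.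
From mathcomp Require Import all_boot all_order all_fingroup all_algebra finmap.
From mathcomp Require Import all_classical all_reals all_analysis.
From mathcomp Require Import ring lra.

Set Implicit Arguments.
Unset Strict Implicit.
Unset Printing Implicit Defensive.

Import Order.TTheory GRing.Theory Num.Theory.
Import numFieldNormedType.Exports.

Local Open Scope classical_set_scope.
Local Open Scope ring_scope.

(** * Birkhoff decomposition of matrices with constant row and column sums *)

(** A permutation [sg] meeting the support of [M] as often as possible works: if it missed the
    support at some [i0], an alternating cycle through [i0] would improve it. *)
Lemma support_perm (R : realFieldType) (T : finType) (M : T -> T -> R) (s : R) :
  0 < s -> (forall i j, 0 <= M i j) ->
  (forall i, \sum_j M i j = s) -> (forall j, \sum_i M i j = s) ->
  exists sigma : {perm T}, forall i, 0 < M i (sigma i).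
Proof.
move=> s0 M0 Mr Mc.
pose good (g : {perm T}) := #|[set i | 0 < M i (g i)]%SET|.
pose sg := [arg max_(g > 1%g) good g].
have {}sg_max g : (good g <= good sg)%N.
  by rewrite /sg; case: arg_maxnP => //= h _; apply.
exists sg => i0; rewrite lt_def M0 andbT; apply/eqP => Mi0.
(* An edge from [i] to [k] means that row [i] may take over the column now matched to [k] and stay
   in the support. *)
pose r : rel T := fun i k => 0 < M i (sg k).
(* The rows of [S] are supported in the columns [sg @: S]; comparing total masses,
   those columns are supported in the rows of [S], so [i0] lies on a cycle. *)
pose S := [set i | connect r i0 i]%SET.
have Sclosed i j : i \in S -> sg j \notin sg @: S -> M i (sg j) = 0.
  rewrite !inE => iS jS; apply/eqP; apply: contraR jS => Mij.
  apply: imset_f; rewrite inE (connect_trans iS) // connect1 //.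
  by rewrite /r lt_def Mij M0.
have rowS i : i \in S -> \sum_(k in S) M i (sg k) = s.
  move=> iS; rewrite -(Mr i) [RHS](reindex_inj (@perm_inj _ sg)) /=.
  rewrite [RHS](bigID (mem S)) /= [X in _ + X]big1 ?addr0 // => k kS.
  by apply: Sclosed => //; rewrite mem_imset //; exact: perm_inj.
have colS k : k \in S -> \sum_(i in S) M i (sg k) = s.
  have le k' : \sum_(i in S) M i (sg k') <= s.
    rewrite -(Mc (sg k')) [leRHS](bigID (mem S)) /= lerDl.
    by apply: sumr_ge0.
  move=> kS; apply/eqP; rewrite eq_le le /=.
  have E : \sum_(i in S) \sum_(k in S) M i (sg k) =
           \sum_(k in S) \sum_(i in S) M i (sg k) by exact: exchange_big.
  rewrite (eq_bigr (fun=> s)) // in E.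
  rewrite -(lerD2r (\sum_(k' in S | k' != k) s)) -bigD1 //= E (bigD1 k) //=.
  by rewrite lerD2l ler_sum.
have i0S : i0 \in S by rewrite inE.
have [k kS Mk] : exists2 k, k \in S & 0 < M k (sg i0).
  apply/exists_inP; apply: contraT; rewrite negb_exists_in => /forall_inP H.
  have := colS _ i0S; rewrite big1 => [/eqP|i iS].
    by rewrite eq_sym (gt_eqF s0).
  by apply/eqP; move: (H _ iS); rewrite lt_def M0 andbT negbK.
move: kS; rewrite inE => /connectP[p0 rp0 kE].
move: Mk; rewrite kE => {kE}; case/shortenP: rp0 => p rp up _ Mk {k p0}.
have cyc : path.cycle r (i0 :: p) by rewrite /= rcons_path rp.
pose h := perm (can_inj (prev_next up)).
pose g := (h * sg)%g.
(* Shifting [sg] along the cycle moves it into the support at [i0], and off it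
   nowhere. *)
have := sg_max g; apply/negP; rewrite -ltnNge; apply: proper_card.
have gE i : g i = sg (next (i0 :: p) i) by rewrite permM permE.
have gpos i : i \in i0 :: p -> 0 < M i (g i).
  by move=> ip; rewrite gE; exact: (next_cycle cyc).
apply/properP; split.
  apply/fintype.subsetP => i; rewrite !inE => Mi.
  have [/gpos//|ip] := boolP (i \in i0 :: p).
  rewrite gE next_nth (negPf ip) //.
exists i0; rewrite !inE ?Mi0 ?ltxx //; apply: gpos; exact: mem_head.
Qed.

(** Induction on the size of the support. Subtracting a permutation inside the support, scaled by
    its smallest entry [eps], keeps the matrix nonnegative, lowers all sums by [eps], and kills at
    least one entry. The element [i0] makes [T] nonempty, whence [s] is nonnegative. *)
Theorem birkhoff (R : realFieldType) (T : finType) (i0 : T) (M : T -> T -> R)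
    (s : R) :
  (forall i j, 0 <= M i j) ->
  (forall i, \sum_j M i j = s) -> (forall j, \sum_i M i j = s) ->
  exists lam : {perm T} -> R, [/\ forall g, 0 <= lam g, \sum_g lam g = s &
    forall i j, M i j = \sum_(g : {perm T} | g i == j) lam g].
Proof.
pose supp (M : T -> T -> R) := [set ij | M ij.1 ij.2 != 0]%SET.
have [n] := ubnP #|supp M|; elim: n M s => // n IH M s /ltnSE Mn M0 Mr Mc.
have s0 : 0 <= s by rewrite -(Mr i0) sumr_ge0.
have [s_eq0|s_neq0] := eqVneq s 0.
  exists (fun=> 0); split => // [|i j]; first by rewrite big1.
  rewrite big1 //; apply/eqP.
  have /eqP := Mr i; rewrite s_eq0 psumr_eq0 // => /allP/(_ j).
  by apply; rewrite mem_index_enum.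
have {s_neq0 s0}s_gt0 : 0 < s by rewrite lt_def s_neq0.
have [sg Msg] := support_perm s_gt0 M0 Mr Mc.
have [i1 i1P] : exists i1, forall i, M i1 (sg i1) <= M i (sg i).
  case: (@Order.TotalTheory.arg_minP _ _ _ i0 predT (fun i => M i (sg i))) => //.
  by move=> i _ H; exists i => k; exact: H.
pose eps := M i1 (sg i1); pose M' i j := M i j - eps *+ (sg i == j).
have [|i j|i|j|lam [lam0 lam_sum lamM]] := IH M' (s - eps).
- apply: leq_trans Mn; apply: proper_card; apply/properP; split.
    apply/fintype.subsetP => -[i j]; rewrite !inE /= /M'.
    have [<- _|_] := eqVneq (sg i) j; last by rewrite mulr0n subr0.
    by rewrite gt_eqF.
  exists (i1, sg i1); rewrite !inE /=; first by rewrite gt_eqF.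
  by rewrite /M' eqxx mulr1n subrr eqxx.
- by rewrite /M'; have [<-|_] := eqVneq; rewrite ?mulr0n ?mulr1n ?subr0 ?subr_ge0.
- rewrite sumrB Mr (bigD1 (sg i)) //= eqxx mulr1n big1 ?addr0 // => j.
  by rewrite eq_sym => /negPf->.
- rewrite sumrB Mc (bigD1 (sg^-1 j)%g) //= permKV eqxx mulr1n big1 ?addr0 // => i.
  by rewrite (can2_eq (permK sg) (permKV sg)) => /negPf->.
exists (fun g => lam g + eps *+ (g == sg)); split.
- by move=> g; rewrite addr_ge0 // mulrn_wge0 // /eps M0.
- rewrite big_split /= lam_sum (bigD1 sg) //= eqxx mulr1n big1 ?addr0 ?subrK //.
  by move=> g /negPf->.
move=> i j; rewrite big_split /= -lamM.
suff -> : \sum_(g : {perm T} | g i == j) eps *+ (g == sg) = eps *+ (sg i == j).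
  by rewrite subrK.
have [<-|sgij] := eqVneq.
  by rewrite (bigD1 sg) //= eqxx mulr1n big1 ?addr0 // => g /andP[_ /negPf->].
by rewrite big1 // => g; have [->|//] := eqVneq g sg; rewrite (negPf sgij).
Qed.

(** * Reduction of plans, costs and distances to finite sums *)

Lemma esum_seq (R : realType) (T : choiceType) (s : seq T) (f : T -> \bar R) :
  uniq s -> (forall i, 0 <= f i)%E -> (forall i, i \notin s -> f i = 0%E) ->
  (\esum_(i in [set: T]) f i = \sum_(i <- s) f i)%E.
Proof.
move=> us f0 fs.
have -> : (\esum_(i in [set: T]) f i = \esum_(i in [set` s]) f i)%E.
  rewrite [RHS]esum_mkcond; apply: eq_esum => i _.
  by rewrite mem_setE; case: ifPn => // /fs.
by rewrite esum_fset // -?fsbig_seq.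
Qed.

Lemma gdist_ge0 (R : realType) (V : choiceType) (e : rel V) (a b : V) :
  (0 <= gdist R e a b)%E.
Proof. by apply/ereal_infP => _ [s _ <-]; rewrite lee_fin. Qed.

Lemma gdist_fin_num (R : realType) (V : choiceType) (e : rel V) (a b : V) s :
  path e a s -> last a s = b -> gdist R e a b \is a fin_num.
Proof.
move=> es sb; rewrite ge0_fin_numE ?gdist_ge0 //.
apply: (@le_lt_trans _ _ ((size s)%:R)%:E); last exact: ltry.
by apply: ereal_inf_lbound; exists s.
Qed.

Lemma gdist_fin_path (R : realType) (V : choiceType) (e : rel V) (a b : V) :
  gdist R e a b \is a fin_num -> exists2 s, path e a s & last a s = b.
Proof.
rewrite ge0_fin_numE ?gdist_ge0 // => /ereal_inf_lt[_ [s [es sb] _] _].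
by exists s.
Qed.

(** A single entry is at most the total of its row and of its column, so a plan vanishes wherever a
    marginal does. Conversely, the bound [pi a b <= 1] is inherited from [mu1 a <= 1]. *)
Lemma transport_planE (R : realType) (V : choiceType) (mu1 mu2 : V -> R)
    (X Y : seq V) (pi : V -> V -> R) :
  uniq X -> uniq Y -> (forall a, a \notin X -> mu1 a = 0) ->
  (forall b, b \notin Y -> mu2 b = 0) -> (forall a, mu1 a <= 1) ->
  transport_plan mu1 mu2 pi <->
  [/\ forall a b, 0 <= pi a b,
      forall a b, a \notin X -> pi a b = 0, forall a b, b \notin Y -> pi a b = 0,
      forall a, \sum_(b <- Y) pi a b = mu1 a
    & forall b, \sum_(a <- X) pi a b = mu2 b].
Proof.
move=> uX uY mu1X mu2Y mu1_le1; split => [[pi01 pi1 pi2]|[pi0 piX piY pi1 pi2]].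
  have pi0 a b : 0 <= pi a b by case/andP: (pi01 a b).
  have piX a b : a \notin X -> pi a b = 0.
    move=> aX; have := pi1 a; rewrite mu1X // => E.
    apply/eqP; rewrite eq_le pi0 andbT -lee_fin -E.
    rewrite -(@esum_set1 _ _ b (fun b => (pi a b)%:E)) ?lee_fin //.
    rewrite esum_mkcond; apply: le_esum => b' _.
    by case: ifP => // _; rewrite lee_fin.
  have piY a b : b \notin Y -> pi a b = 0.
    move=> bY; have := pi2 b; rewrite mu2Y // => E.
    apply/eqP; rewrite eq_le pi0 andbT -lee_fin -E.
    rewrite -(@esum_set1 _ _ a (fun a => (pi a b)%:E)) ?lee_fin //.
    rewrite esum_mkcond; apply: le_esum => a' _.
    by case: ifP => // _; rewrite lee_fin.
  split => // [a|b]; apply: EFin_inj.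
  - rewrite -pi1 (esum_seq uY) ?sumEFin // => b; first by rewrite lee_fin.
    by move=> /piY->.
  - rewrite -pi2 (esum_seq uX) ?sumEFin // => a; first by rewrite lee_fin.
    by move=> /piX->.
split => [a b|a|b].
- rewrite pi0 /=; have [bY|/piY->] := boolP (b \in Y); last exact: ler01.
  apply: le_trans (mu1_le1 a); rewrite -pi1 (bigD1_seq b) //= lerDl.
  exact: sumr_ge0.
- rewrite -pi1 (esum_seq uY) ?sumEFin // => b; first by rewrite lee_fin.
  by move=> /piY->.
- rewrite -pi2 (esum_seq uX) ?sumEFin // => a; first by rewrite lee_fin.
  by move=> /piX->.
Qed.

(** Pairs outside [X] and [Y] contribute a product with zero, even at infinite distance; the
    remaining distances are finite and the cost becomes a real number. *)
Lemma transport_costE (R : realType) (V : choiceType) (e : rel V)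
    (X Y : seq V) (pi : V -> V -> R) :
  uniq X -> uniq Y -> (forall a b, 0 <= pi a b) ->
  (forall a b, a \notin X -> pi a b = 0) ->
  (forall a b, b \notin Y -> pi a b = 0) ->
  {in X & Y, forall a b, gdist R e a b \is a fin_num} ->
  transport_cost e pi =
    (\sum_(a <- X) \sum_(b <- Y) fine (gdist R e a b) * pi a b)%:E.
Proof.
move=> uX uY pi0 piX piY fin; rewrite /transport_cost.
have gpi0 a b : (0 <= gdist R e a b * (pi a b)%:E)%E.
  by rewrite mule_ge0 ?gdist_ge0 ?lee_fin.
rewrite (esum_seq uX) => [|a|a aX]; last 2 first.
- exact: esum_ge0.
- by apply: esum1 => b _; rewrite piX // mule0.
rewrite -sumEFin; apply: eq_big_seq => a aX.
rewrite (esum_seq uY) // => [|b bY]; last by rewrite piY // mule0.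
rewrite -sumEFin; apply: eq_big_seq => b bY.
by rewrite EFinM fineK // fin.
Qed.

(** * Minimal cost of matrices with one exceptional marginal *)

Definition marginal (R : realFieldType) (T : finType) (i0 : T) (p s : R) (i : T) :=
  if i == i0 then p else s.

Definition has_marginals (R : realFieldType) (T : finType) (f g : T -> R)
    (M : T -> T -> R) :=
  [/\ forall i j, 0 <= M i j, forall i, \sum_j M i j = f i
    & forall j, \sum_i M i j = g j].

Definition matrix_cost (R : realFieldType) (T : finType) (c M : T -> T -> R) :=
  \sum_i \sum_j c i j * M i j.

Lemma sum_delta (R : realFieldType) (T : finType) (i : T) (F : T -> R) (a : R) :
  \sum_j F j * (a *+ (i == j)) = F i * a.
Proof.
rewrite (bigD1 i) //= eqxx mulr1n big1 ?addr0 // => j.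
by rewrite eq_sym => /negPf->; rewrite mulr0.
Qed.

Lemma sum_delta1 (R : realFieldType) (T : finType) (i : T) (a : R) :
  \sum_j a *+ (i == j) = a.
Proof.
rewrite -[RHS]mul1r -(sum_delta i (fun=> 1)).
by apply: eq_bigr => j _; rewrite mul1r.
Qed.

Lemma marginal_slack (R : realFieldType) (T : finType) (i0 : T) (p s : R) i :
  marginal i0 p s i + (s - p) *+ (i0 == i) = s.
Proof.
rewrite /marginal eq_sym; case: eqVneq => _; last by rewrite mulr0n addr0.
by rewrite mulr1n addrC subrK.
Qed.

Lemma sum_slack (R : realFieldType) (T : finType) (i0 i : T) (a : R) :
  \sum_j a *+ ((i0 == i) && (i0 == j)) = a *+ (i0 == i).
Proof.
have [_|_] := eqVneq i0 i; last by rewrite big1.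
exact: sum_delta1.
Qed.

Lemma matrix_cost_slack (R : realFieldType) (T : finType) (i0 : T)
    (c : T -> T -> R) (a : R) :
  matrix_cost c (fun i j => a *+ ((i0 == i) && (i0 == j))) = c i0 i0 * a.
Proof.
rewrite /matrix_cost -(sum_delta i0 (fun i => c i i0)); apply: eq_bigr => i _ /=.
have [<-|_] := eqVneq i0 i; first by rewrite sum_delta.
by rewrite big1 ?mulr0n ?mulr0 // => j _; rewrite mulr0.
Qed.

Lemma matrix_costD (R : realFieldType) (T : finType) (c M N : T -> T -> R) :
  matrix_cost c (fun i j => M i j + N i j) = matrix_cost c M + matrix_cost c N.
Proof.
rewrite /matrix_cost -big_split; apply: eq_bigr => i _.
by rewrite -big_split; apply: eq_bigr => j _; rewrite /= mulrDr.
Qed.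

Lemma matrix_cost_perm (R : realFieldType) (T : finType) (c : T -> T -> R)
    (g : {perm T}) (a : R) :
  matrix_cost c (fun i j => a *+ (g i == j)) = a * \sum_i c i (g i).
Proof.
rewrite /matrix_cost mulr_sumr; apply: eq_bigr => i _.
by rewrite sum_delta mulrC.
Qed.

(* Adding mass [s - p] at [(i0, i0)] makes all marginals equal to [s]; in a
   Birkhoff decomposition of the result the permutations fixing [i0] carry at
   least this mass, so removing it again leaves them the cost of the remaining
   assignment. *)
Theorem min_cost_affine (R : realFieldType) (T : finType) (i0 : T)
    (c : T -> T -> R) :
  exists a b : R, forall p s : R, 0 <= p <= s ->
    (forall M, has_marginals (marginal i0 p s) (marginal i0 p s) M ->
       a * p + b * s <= matrix_cost c M) /\
    (exists2 M, has_marginals (marginal i0 p s) (marginal i0 p s) M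
       & matrix_cost c M = a * p + b * s).
Proof.
pose cost (g : {perm T}) := \sum_i c i (g i).
have [rho rhoP] : exists rho, forall g, cost rho <= cost g.
  by case: (@Order.TotalTheory.arg_minP _ _ _ 1%g predT cost) => // g _ H;
    exists g => k; exact: H.
have [tau [tau0 tauP]] : exists tau : {perm T}, tau i0 = i0 /\
    forall g : {perm T}, g i0 = i0 -> cost tau <= cost g.
  case: (@Order.TotalTheory.arg_minP _ _ _ 1%g (fun g : {perm T} => g i0 == i0) cost).
    by rewrite perm1.
  by move=> g /eqP gi0 H; exists g; split => // k /eqP; exact: H.
(* With [K := cost rho] and [J := cost tau - c i0 i0], these are the coefficients of [p] and [s] in
   [p * K + (s - p) * J]. *)
exists (cost rho - (cost tau - c i0 i0)), (cost tau - c i0 i0) => p s /andP[p0 ps].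
pose D i j := (s - p) *+ ((i0 == i) && (i0 == j)).
have sumD i : \sum_j D i j = (s - p) *+ (i0 == i) by exact: sum_slack.
have sumD' j : \sum_i D i j = (s - p) *+ (i0 == j).
  by rewrite -sum_slack; apply: eq_bigr => i _; rewrite /D andbC.
have D0 i j : 0 <= D i j by rewrite mulrn_wge0 // subr_ge0.
split=> [M [M0 Mr Mc]|].
  pose M' i j := M i j + D i j.
  have [i j|i|j|lam [lam0 lam_sum lamM]] := @birkhoff R T i0 M' s.
  - by rewrite addr_ge0.
  - by rewrite big_split /= Mr sumD marginal_slack.
  - by rewrite big_split /= Mc sumD' marginal_slack.
  have costM' : matrix_cost c M' = \sum_g lam g * cost g.
    rewrite /matrix_cost; under [RHS]eq_bigr do rewrite mulr_sumr.
    rewrite [RHS]exchange_big; apply: eq_bigr => i _ /=.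
    under eq_bigr do rewrite lamM mulr_sumr.
    rewrite (exchange_big_dep predT) //=; apply: eq_bigr => g _.
    by rewrite (big_pred1 (g i)) => [|j]; rewrite 1?mulrC //= eq_sym.
  have : matrix_cost c M' = matrix_cost c M + c i0 i0 * (s - p).
    by rewrite matrix_costD matrix_cost_slack.
  rewrite costM' (bigID (fun g : {perm T} => g i0 == i0)) /= => E.
  have lamI : s - p <= \sum_(g : {perm T} | g i0 == i0) lam g.
    by rewrite -lamM /M' /D !eqxx mulr1n lerDr M0.
  have le1 : (\sum_(g : {perm T} | g i0 == i0) lam g) * cost tau <=
      \sum_(g : {perm T} | g i0 == i0) lam g * cost g.
    rewrite mulr_suml; apply: ler_sum => g /eqP gi0.
    by rewrite ler_wpM2l // tauP.
  have le2 : (\sum_(g : {perm T} | g i0 != i0) lam g) * cost rho <=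
      \sum_(g : {perm T} | g i0 != i0) lam g * cost g.
    by rewrite mulr_suml; apply: ler_sum => g _; rewrite ler_wpM2l.
  move: lam_sum; rewrite (bigID (fun g : {perm T} => g i0 == i0)) /= => lam_sum.
  (* If the permutations fixing [i0] have total weight [A], the others have weight [s - A], and the
     cost of [M'] is at least [A * cost tau + (s - A) * cost rho]. As [cost rho <= cost tau], this
     is smallest at the least admissible weight [A = s - p]. *)
  move: (rhoP tau); nra.
(* Weight [p] on [rho] and [s - p] on [tau]; since [tau] fixes [i0], the mass [s - p] at [(i0, i0)]
   can be removed without making an entry negative. *)
exists (fun i j => (p *+ (rho i == j) + (s - p) *+ (tau i == j)) - D i j).
  split=> [i j|i|j].
  - rewrite subr_ge0 /D; apply: le_trans (_ : (s - p) *+ (tau i == j) <= _).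
      rewrite ler_wpMn2l ?subr_ge0 //.
      case: eqP => //= <-; case: eqP => //= <-.
      by rewrite tau0 eqxx.
    by rewrite lerDr mulrn_wge0.
  - rewrite sumrB sumD big_split /=.
    rewrite !sum_delta1.
    have := marginal_slack i0 p s i; lra.
  - rewrite sumrB sumD' big_split /=.
    have col (g : {perm T}) (a : R) : \sum_i a *+ (g i == j) = a.
      rewrite (reindex_inj (@perm_inj _ g^-1%g)) /=.
      by under eq_bigr do rewrite permKV eq_sym; rewrite sum_delta1.
    rewrite !col; have := marginal_slack i0 p s j; lra.
have : matrix_cost c (fun i j => p *+ (rho i == j) + (s - p) *+ (tau i == j)) =
    p * cost rho + (s - p) * cost tau.
  by rewrite matrix_costD !matrix_cost_perm.
have : matrix_cost c D = c i0 i0 * (s - p) by exact: matrix_cost_slack.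
set P := fun i j => p *+ _ + _ => ED EP.
have : matrix_cost c (fun i j => (P i j - D i j) + D i j) = matrix_cost c P.
  by apply: eq_bigr => i _; apply: eq_bigr => j _; rewrite subrK.
rewrite matrix_costD ED EP => E.
have -> : matrix_cost c (fun i j => P i j - D i j) =
  p * cost rho + (s - p) * cost tau - c i0 i0 * (s - p) by rewrite -E addrK.
ring.
Qed.

(* The weights [w] have sum 1 on each fiber of [u]. *)
Definition weighted_cover (R : realFieldType) (T : finType) (V : eqType)
    (u : T -> V) (w : T -> R) (X : seq V) :=
  [/\ uniq X, forall i, u i \in X, forall i, 0 <= w i
    & forall F : V -> R, \sum_i w i * F (u i) = \sum_(a <- X) F a].

(** * Transfer between transport plans and matrices through weighted copies *)

Section Transfer.
Variables (R : realType) (T : finType) (V : choiceType).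
Variables (u v : T -> V) (wu wv : T -> R) (X Y : seq V) (mu1 mu2 : V -> R).
Hypotheses (uP : weighted_cover u wu X) (vP : weighted_cover v wv Y).
Hypotheses (mu1X : forall a, a \notin X -> mu1 a = 0).
Hypotheses (mu2Y : forall b, b \notin Y -> mu2 b = 0).
Hypothesis mu1_le1 : forall a, mu1 a <= 1.

Let f i := wu i * mu1 (u i).
Let g j := wv j * mu2 (v j).

(** The mass moved from [a] to [b] is spread over the pairs of copies of [a] and [b] in proportion
    to the product of their weights, and the cover property adds it up again. *)
Lemma plan_to_matrix (pi : V -> V -> R) (c : V -> V -> R) :
  transport_plan mu1 mu2 pi ->
  exists2 M, has_marginals f g M & matrix_cost (fun i j => c (u i) (v j)) M =
    \sum_(a <- X) \sum_(b <- Y) c a b * pi a b.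
Proof.
case: uP vP => uX uin wu0 sumu [uY vin wv0 sumv].
move=> /(transport_planE _ uX uY mu1X mu2Y mu1_le1)[pi0 piX piY pi1 pi2].
exists (fun i j => wu i * (wv j * pi (u i) (v j))).
  split=> [i j|i|j]; first by rewrite !mulr_ge0.
    by rewrite -mulr_sumr (sumv (fun b => pi (u i) b)) pi1.
  rewrite (sumu (fun a => wv j * pi a (v j))) -mulr_sumr pi2 //.
rewrite /matrix_cost -(sumu (fun a => \sum_(b <- Y) c a b * pi a b)).
apply: eq_bigr => i _; rewrite -(sumv (fun b => c (u i) b * pi (u i) b)).
by rewrite mulr_sumr; apply: eq_bigr => j _; ring.
Qed.

(** The plan is the image of [M] under [u] and [v]: it collects the entries over all pairs of
    copies. The cost depends only on the vertices behind the copies and is preserved. *)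
Lemma matrix_to_plan (M : T -> T -> R) (c : V -> V -> R) :
  has_marginals f g M ->
  exists2 pi, transport_plan mu1 mu2 pi &
    \sum_(a <- X) \sum_(b <- Y) c a b * pi a b =
    matrix_cost (fun i j => c (u i) (v j)) M.
Proof.
case: uP vP => uX uin wu0 sumu [uY vin wv0 sumv] [M0 Mr Mc].
have pick (Z : seq V) (z : V) (F : V -> R) : uniq Z -> z \in Z ->
    \sum_(a <- Z) (z == a)%:R * F a = F z.
  move=> uZ zZ; rewrite (bigD1_seq z) //= eqxx mul1r big1 ?addr0 // => a.
  by rewrite eq_sym => /negPf->; rewrite mul0r.
have pick' (Z : seq V) (z : V) (F : V -> R) : uniq Z ->
    (z \notin Z -> F z = 0) -> \sum_(a <- Z) (a == z)%:R * F a = F z.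
  move=> uZ Fz; have [zZ|zZ] := boolP (z \in Z).
    by rewrite -[RHS](pick Z) //; apply: eq_bigr => a _; rewrite eq_sym.
  rewrite Fz // big_seq big1 // => a aZ.
  by case: eqP zZ => [<-|]; rewrite ?aZ ?mul0r.
pose pi a b := \sum_i (u i == a)%:R * (\sum_j (v j == b)%:R * M i j).
have sumX (F : V -> V -> R) b : \sum_(a <- X) F a b * pi a b =
    \sum_i F (u i) b * \sum_j (v j == b)%:R * M i j.
  under eq_bigr do rewrite mulr_sumr.
  rewrite exchange_big; apply: eq_bigr => i _ /=.
  rewrite -(pick X (u i) (fun a => F a b * \sum_j (v j == b)%:R * M i j)) //.
  by apply: eq_bigr => a _; rewrite mulrCA.
have sumY (F : V -> R) i : \sum_(b <- Y) F b * (\sum_j (v j == b)%:R * M i j) =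
    \sum_j F (v j) * M i j.
  under eq_bigr do rewrite mulr_sumr.
  rewrite exchange_big; apply: eq_bigr => j _ /=.
  rewrite -(pick Y (v j) (fun b => F b * M i j)) //.
  by apply: eq_bigr => b _; rewrite mulrCA.
exists pi.
  apply/(transport_planE _ uX uY mu1X mu2Y mu1_le1); split.
  - move=> a b; apply: sumr_ge0 => i _; rewrite mulr_ge0 ?ler0n //.
    by apply: sumr_ge0 => j _; rewrite mulr_ge0 ?ler0n.
  - move=> a b aX; rewrite /pi big1 // => i _.
    by case: eqP aX => [<-|]; rewrite ?uin ?mul0r.
  - move=> a b bY; rewrite /pi big1 // => i _; rewrite big1 ?mulr0 // => j _.
    by case: eqP bY => [<-|]; rewrite ?vin ?mul0r.
  - move=> a; rewrite exchange_big /= -(pick' X) //; last exact: mu1X.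
    rewrite -sumu; apply: eq_bigr => i _.
    rewrite -mulr_sumr mulrCA -/(f i) -Mr; congr (_ * _).
    rewrite (eq_bigr (fun b => 1 * \sum_j (v j == b)%:R * M i j)) => [|b _].
      by rewrite (sumY (fun=> 1)); apply: eq_bigr => j _; rewrite mul1r.
    by rewrite mul1r.
  - move=> b; rewrite (eq_bigr (fun a => 1 * pi a b)) => [|a _]; last first.
      by rewrite mul1r.
    rewrite (sumX (fun _ _ => 1)) -(pick' Y) //; last exact: mu2Y.
    rewrite -sumv; under eq_bigr do rewrite mul1r.
    rewrite exchange_big; apply: eq_bigr => j _ /=.
    by rewrite mulrCA -/(g j) -Mc mulr_sumr.
rewrite exchange_big /=; under eq_bigr do rewrite sumX.
rewrite exchange_big; apply: eq_bigr => i _ /=; exact: sumY.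
Qed.
End Transfer.

(* [L] is meant to be [k * size s]: index 0 stands for the center [x], and each
   element of [s] has [k] copies of weight [1 / k] among the other indices. *)
Section Star.
Variables (R : realType) (V : eqType) (x : V) (s : seq V) (k : nat).

Definition star_vertex L (i : 'I_L.+1) : V :=
  if (i : nat) is j.+1 then nth x s (j %% size s) else x.

Definition star_weight L (i : 'I_L.+1) : R := if i == ord0 then 1 else k%:R^-1.

(** The nonzero indices form [k] consecutive blocks of length [size s]; reduction modulo [size s]
    makes each block run once through [s], and the weight [1 / k] averages the [k] equal block
    sums. *)
Lemma star_cover L : uniq (x :: s) -> (0 < size s)%N -> (0 < k)%N ->
  L = (k * size s)%N -> weighted_cover (@star_vertex L) (@star_weight L) (x :: s).
Proof.
move=> us s0 k0 ->; split=> // [[[|j] jL]|i|F].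
- exact: mem_head.
- by rewrite inE /star_vertex /= mem_nth ?orbT // ltn_pmod.
- by rewrite /star_weight; case: ifP => _; rewrite ?ler01 // invr_ge0 ler0n.
rewrite big_ord_recl big_cons /star_weight eqxx mul1r; congr (_ + _).
rewrite (eq_bigr (fun i : 'I_ _ => k%:R^-1 * F (nth x s (i %% size s)))) //.
rewrite -mulr_sumr -(big_mkord predT (fun i => F (nth x s (i %% size s)))).
rewrite big_nat_mul.
transitivity (k%:R^-1 * \sum_(0 <= i < k) \sum_(a <- s) F a); last first.
  rewrite sumr_const_nat subn0 -[X in _ * X]mulr_natl mulKf //.
  by rewrite pnatr_eq0 -lt0n.
congr (_ * _); apply: eq_bigr => i _.
rewrite (big_nth x) mulSn -{1}[(i * size s)%N]add0n big_addn addnK.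
rewrite !big_mkord; apply: eq_bigr => j _.
by rewrite addnC modnMDl modn_small.
Qed.
End Star.

(** * The Wasserstein distance between lazy measures for small [p] *)

Section LazyMeasure.
Variables (R : realType) (V : choiceType) (e : rel V).
Hypotheses (e_simple : simple_graph e) (e_lf : locally_finite e).

Definition neighbor_seq (v : V) : seq V := fset_set (neighbors e v).

Lemma mem_neighbor_seq v w : (w \in neighbor_seq v) = e v w.
Proof. by rewrite in_fset_set // mem_setE. Qed.

Lemma uniq_star v : uniq (v :: neighbor_seq v).
Proof. by rewrite /= fset_uniq mem_neighbor_seq e_simple.2. Qed.

Lemma lazy_measure_out (p : R) v z :
  z \notin v :: neighbor_seq v -> lazy_measure e p v z = 0.
Proof.
by rewrite inE negb_or mem_neighbor_seq /lazy_measure => /andP[/negPf-> /negPf->].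
Qed.

Lemma lazy_measure_le1 (p : R) v z : 0 <= p <= 1 -> lazy_measure e p v z <= 1.
Proof.
move=> /andP[p0 p1]; rewrite /lazy_measure; case: ifP => // _.
case: ifP => [|_]; last exact: ler01.
rewrite -mem_neighbor_seq => vz.
have d1 : 1 <= (degree e v)%:R :> R by rewrite ler1n cardfs_gt0; apply/fset0Pn; exists z.
rewrite ler_pdivrMr; first lra.
lra.
Qed.

(** A neighbor carries [(1 - p) / degree e v], and each of its [k] copies one [k]-th of that. The
    result depends on [v] only through [L], so a common multiple of two degrees gives both measures
    the same marginals. *)
Lemma star_weight_lazy_measure (p : R) v k L (i : 'I_L.+1) :
  (0 < degree e v)%N -> L = (k * degree e v)%N ->
  star_weight R k i * lazy_measure e p v (star_vertex v (neighbor_seq v) i) =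
  marginal ord0 p ((1 - p) / L%:R) i.
Proof.
move=> d0 LE; rewrite /star_weight /marginal /star_vertex.
case: i => [[|j] jL] /=; first by rewrite /lazy_measure eqxx mul1r.
set w := nth _ _ _.
have ew : e v w by rewrite -mem_neighbor_seq mem_nth // ltn_pmod.
have /negPf wv : w != v by apply: contraTneq ew => ->; rewrite e_simple.2.
by rewrite /lazy_measure wv ew LE natrM invfM mulrCA.
Qed.

Lemma star_path v z : z \in v :: neighbor_seq v ->
  exists2 s, path e v s & last v s = z.
Proof.
rewrite inE mem_neighbor_seq => /predU1P[->|vz]; first by exists [::].
by exists [:: z]; rewrite //= vz.
Qed.

(** Walk from [a] to its center [x], along a path to [y], and out to [b]. *)
Lemma gdist_star_fin_num x y a b : gdist R e x y \is a fin_num ->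
  a \in x :: neighbor_seq x -> b \in y :: neighbor_seq y ->
  gdist R e a b \is a fin_num.
Proof.
move=> /gdist_fin_path[s es sy] ax /star_path[t et tb].
have [r er rx] : exists2 r, path e a r & last a r = x.
  move: ax; rewrite inE mem_neighbor_seq => /predU1P[->|xa]; first by exists [::].
  by exists [:: x]; rewrite //= e_simple.1 xa.
apply: (@gdist_fin_num _ _ _ _ _ (r ++ s ++ t)).
  by rewrite !cat_path er rx es sy et.
by rewrite !last_cat rx sy tb.
Qed.

Theorem W1_lazy_affine (x y : V) :
  gdist R e x y \is a fin_num -> (0 < degree e x)%N -> (0 < degree e y)%N ->
  let L := lcmn (degree e x) (degree e y) in
  exists a b : R, forall p : R, 0 <= p <= 1 / (1 + L%:R) ->
    W1 e (lazy_measure e p x) (lazy_measure e p y) = (a * p + b)%:E.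
Proof.
move=> xy_fin dx dy L.
have L0 : (0 < L)%N by rewrite lcmn_gt0 dx.
have LxE : L = (L %/ degree e x * degree e x)%N by rewrite divnK ?dvdn_lcml.
have LyE : L = (L %/ degree e y * degree e y)%N by rewrite divnK ?dvdn_lcmr.
have kx : (0 < L %/ degree e x)%N by move: L0; rewrite {1}LxE muln_gt0 => /andP[].
have ky : (0 < L %/ degree e y)%N by move: L0; rewrite {1}LyE muln_gt0 => /andP[].
set X := x :: neighbor_seq x; set Y := y :: neighbor_seq y.
have uP := star_cover R (uniq_star x) dx kx LxE.
have vP := star_cover R (uniq_star y) dy ky LyE.
pose c a b : R := fine (gdist R e a b).
have [a [b abP]] := min_cost_affine (ord0 : 'I_L.+1)
  (fun i j => c (star_vertex x (neighbor_seq x) i) (star_vertex y (neighbor_seq y) j)).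
have L0R : 0 < L%:R :> R by rewrite ltr0n.
(* Coefficients of [a * p + b * s] after substituting [s = (1 - p) / L]. *)
exists (a - b / L%:R), (b / L%:R) => p; rewrite ler_pdivlMr; last lra.
move=> /andP[p0 pq].
have p1 : 0 <= p <= 1 by rewrite p0; nra.
(* The threshold enters here: [p * (1 + L) <= 1] rearranges to [p <= (1 - p) / L], the condition of
   [min_cost_affine]. *)
have ps : 0 <= p <= (1 - p) / L%:R by rewrite p0 ler_pdivlMr; lra.
have {abP}[lower [M MP Mcost]] := abP _ _ ps.
have valE : a * p + b * ((1 - p) / L%:R) = (a - b / L%:R) * p + b / L%:R by field; rewrite gt_eqF.
rewrite {}valE in lower Mcost.
have le1 z : lazy_measure e p x z <= 1 by exact: lazy_measure_le1.
have costE pi : transport_plan (lazy_measure e p x) (lazy_measure e p y) pi ->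
    transport_cost e pi = (\sum_(a <- X) \sum_(b <- Y) c a b * pi a b)%:E.
  move=> /(transport_planE _ (uniq_star x) (uniq_star y) (@lazy_measure_out p x)
    (@lazy_measure_out p y) le1)[pi0 piX piY _ _].
  apply: transport_costE => //; try exact: uniq_star.
  by move=> ? ?; exact: gdist_star_fin_num.
have margX i := star_weight_lazy_measure p i dx LxE.
have margY i := star_weight_lazy_measure p i dy LyE.
(* Upper bound: the optimal matrix [M] yields a plan of the same cost. Lower bound: every plan
   yields a matrix of the same cost. *)
apply/eqP; rewrite eq_le; apply/andP; split.
  have [|pi piP piE] := matrix_to_plan uP vP (@lazy_measure_out p x)
    (@lazy_measure_out p y) le1 (M := M) c.
    case: MP => M0 Mr Mc; split=> // [i|j]; first by rewrite margX Mr.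
    by rewrite margY Mc.
  apply: ereal_inf_lbound; exists pi => //.
  by rewrite costE // piE Mcost.
apply/ereal_infP => _ [pi piP <-]; rewrite costE // lee_fin.
have [N [N0 Nr Nc] <-] := plan_to_matrix uP vP (@lazy_measure_out p x)
  (@lazy_measure_out p y) le1 c piP.
by apply: lower; split=> // [i|j]; rewrite ?Nr ?margX ?Nc ?margY.
Qed.
End LazyMeasure.

(** * Critical points and the curvature *)

(** If [p < q], the derivative is constantly [a] on both sides of [p] inside the open interval from
    [0] to [q], so both one-sided limits equal [a]. *)
Lemma affine_not_critical (R : realType) (f : R -> R) (a b q p : R) :
  (forall t, 0 <= t <= q -> f t = a * t + b) -> critical_point f p -> q <= p.
Proof.
move=> fE [/andP[p0 p1]] [l [r [fl fr]]]; apply: contra_notP => /negP.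
rewrite -ltNge => pq.
have df t : 0 < t < q -> derive1 f t = a.
  move=> /andP[t0 tq]; rewrite derive1E.
  rewrite (@near_eq_derive _ _ _ f (fun t => a * t + b)).
    rewrite deriveD // deriveM // derive_id !derive_cst.
    by rewrite scaler0 !addr0 -[a *: _]/(a * 1) mulr1.
  near=> u; apply: fE; apply/andP; split; apply: ltW; near: u.
    exact: lt_nbhsr.
  exact: lt_nbhsl.
have -> : l = a.
  apply: (@cvg_unique _ _ (derive1 f @ p^'-)) => //.
  apply: cvg_near_cst; near=> t; apply: df; apply/andP; split; near: t.
    exact: nbhs_left_gt.
  near=> t; apply: lt_trans pq; near: t; exact: nbhs_left_lt.
apply/esym; apply: (@cvg_unique _ _ (derive1 f @ p^'+)) => //.
apply: cvg_near_cst; near=> t; apply: df; apply/andP; split; near: t.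
  near=> t; apply: lt_trans p0 _; near: t; exact: nbhs_right_gt.
exact: nbhs_right_lt.
Unshelve. all: by end_near. Qed.

Theorem mainTheorem3 (R : realType) (V : choiceType) (e : rel V)
    (e_simple : simple_graph e) (e_lf : locally_finite e)
    (x y : V) (delta : nat) (delta_ge2 : (2 <= delta)%N)
    (dxy : gdist R e x y = (delta%:R)%:E) :
  let q : R := 1 / (1 + (lcmn (degree e x) (degree e y))%:R) in
  (forall p : R, critical_point (kappa e x y) p -> q <= p) /\
  (exists a b : R, forall p : R, 0 <= p <= q -> kappa e x y p = a * p + b).
Proof.
move=> q.
have xy_fin : gdist R e x y \is a fin_num by rewrite dxy.
(* The empty path would give distance [0], against [delta >= 2]. *)
have xy : x != y.
  apply: contraTneq delta_ge2 => xy; rewrite -leqNgt.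
  have : (gdist R e x y <= 0%:E)%E by apply: ereal_inf_lbound; exists [::].
  by rewrite dxy lee_fin lern0 => /eqP->.
have deg_gt0 v w : e v w -> (0 < degree e v)%N.
  by move=> vw; rewrite cardfs_gt0; apply/fset0Pn; exists w; rewrite in_fset_set // mem_setE.
have [s es sy] := gdist_fin_path xy_fin.
(* As [x] and [y] differ, the path joining them has a first edge at [x] and a last edge at [y], so
   neither vertex is isolated. *)
have dx : (0 < degree e x)%N.
  case: s es sy => [|w s] /= => [_ /eqP|/andP[/deg_gt0//]].
  by rewrite (negPf xy).
have dy : (0 < degree e y)%N.
  case/lastP: s es sy => [|s w] /= => [_ /eqP|]; first by rewrite (negPf xy).
  rewrite rcons_path last_rcons => /andP[_ ew] <-.
  by apply: (@deg_gt0 _ (last x s)); rewrite e_simple.1.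
have [a [b W1E]] := W1_lazy_affine e_simple e_lf xy_fin dx dy.
have kE : forall p : R, 0 <= p <= q ->
    kappa e x y p = - (a / delta%:R) * p + (1 - b / delta%:R).
  by move=> p /W1E Wp; rewrite /kappa Wp dxy /=; ring.
split; last by exists (- (a / delta%:R)), (1 - b / delta%:R).
by move=> p; exact: affine_not_critical kE.
Qed.
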